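(* There is an absolute constant $C>0$ such that for all integers $d,n\geq 2$ with $n\geq d+\log d$ one has $$ |r_{d,n}-1|\leq \frac{C}{d^{1/4}}. $$ In other words, $r_{d,n}=1+O(d^{-1/4})$ for $n\geq d+\log d$, with an absolute implied constant.
   Context: For integers $d,n\geq 2$, let $\mathbb{B}_{d,n}$ be the set of hypersurfaces in $\mathbb{P}^n$ (over $\mathbb{Q}$) defined by the vanishing of a homogeneous polynomial of degree $d$ in $x_0,\dots,x_n$ all of whose coefficients (one for each of the $N_{d,n}=\binom{n+d}{d}$ monomials of degree $d$ in $n+1$ variables) lie in $\{-1,1\}$. Two such polynomials are regarded as defining the same hypersurface exactly when they agree up to sign, so $\#\mathbb{B}_{d,n}=2^{N_{d,n}-1}$. Define $$ r_{d,n}=\frac{\#\{V\in\mathbb{B}_{d,n}: V(\mathbb{Q})\neq\emptyset\}}{\#\mathbb{B}_{d,n}}, $$ where $V(\mathbb{Q})$ is the set of points of $\mathbb{P}^n(\mathbb{Q})$ lying on $V$. Here $\log$ is the natural logarithm. *)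

(* Defs.v *)
From HB Require Import structures.
From mathcomp Require Import all_boot all_order all_algebra.
From mathcomp Require Import boolp reals exp.
From mathcomp Require mpoly.
(* The notations of mpoly clash with those of mathcomp-analysis: mpoly n K is
   {mpoly K[n]}, bmultinom n b is the finite type 'X_{1..n < b} of exponent
   vectors of degree < b, mpolyX K m is 'X_[m], mcoeff m f is f@_m and
   meval x f is f.@[x]. *)
Import -(notations) mpoly.

Set Implicit Arguments.
Unset Strict Implicit.
Unset Printing Implicit Defensive.

Import Order.TTheory GRing.Theory Num.Theory.
Local Open Scope ring_scope.

Definition monomial (d n : nat) : finType :=
  {m : bmultinom n.+1 d.+1 | mdeg m == d}.

(* s m = true means that the coefficient of the monomial m is -1; see sign_polyP
   for the polynomials this describes. *)
Definition signs (d n : nat) : finType := {ffun monomial d n -> bool}.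

Definition sign_poly (d n : nat) (s : signs d n) : mpoly n.+1 rat :=
  \sum_(m : monomial d n) (-1) ^+ s m *: mpolyX rat (val m).

Definition same_hypersurface (d n : nat) (s t : signs d n) : bool :=
  (sign_poly s == sign_poly t) || (sign_poly s == - sign_poly t).

(* A hypersurface is a class of polynomials up to sign; see card_BB. *)
Definition BB (d n : nat) : {set {set signs d n}} :=
  equivalence_partition (@same_hypersurface d n) [set: signs d n].

Lemma mcoeff_sign_poly d n (s : signs d n) (m : monomial d n) :
  mcoeff (val m) (sign_poly s) = (-1) ^+ s m.
Proof.
rewrite raddf_sum (bigD1 m) //= mcoeffZ mcoeffX eqxx mulr1 big1 ?addr0 // => k.
move=> nkm; rewrite mcoeffZ mcoeffX; case: eqP => [e|]; last by rewrite mulr0.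
by case/eqP: nkm; apply/val_inj/val_inj.
Qed.

Lemma sign_polyP d n (f : mpoly n.+1 rat) :
  (exists s : signs d n, f = sign_poly s) <->
  f \is @ishomog1 n.+1 rat d mdeg /\
  (forall m, mdeg m = d -> mcoeff m f = 1 \/ mcoeff m f = -1).
Proof.
have mon m : mdeg m = d -> exists k : monomial d n, m = val k.
  move=> hm; have hb : (mdeg m < d.+1)%N by rewrite hm.
  have hk : mdeg (BMultinom hb) == d by apply/eqP.
  by exists (Sub (BMultinom hb) hk).
split=> [[s ->]|[hf hc]].
  split; last first.
    by move=> m /mon[k ->]; rewrite mcoeff_sign_poly; case: (s k); [right|left].
  apply: rpred_sum => m _; apply: rpredZ.
  by rewrite dhomogX; exact: (valP m).
exists [ffun m : monomial d n => mcoeff (val m) f == -1].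
apply/mpolyP => m; have [hm|hm] := eqVneq (mdeg m) d.
  have [k ek] := mon m hm; rewrite ek mcoeff_sign_poly ffunE.
  by case: (hc m hm) => e; rewrite -ek e.
rewrite (dhomog_nemf_coeff hf hm) raddf_sum big1 // => k _ /=.
rewrite mcoeffZ mcoeffX; case: eqP => [e|]; last by rewrite mulr0.
by case/eqP: hm; rewrite -e; apply/eqP/(valP k).
Qed.

Definition opp_signs d n (s : signs d n) : signs d n := [ffun m => ~~ s m].

Lemma sign_poly_inj {d n} : injective (@sign_poly d n).
Proof.
move=> s t e; apply/ffunP => m.
move/(congr1 (mcoeff (val m))): e; rewrite !mcoeff_sign_poly.
by case: (s m) (t m) => -[].
Qed.

Lemma sign_polyN d n (s : signs d n) : sign_poly (opp_signs s) = - sign_poly s.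
Proof.
rewrite /sign_poly -sumrN; apply: eq_bigr => m _.
by rewrite ffunE signrN scaleNr.
Qed.

Lemma same_hypersurfaceE d n (s t : signs d n) :
  same_hypersurface s t = (t == s) || (t == opp_signs s).
Proof.
rewrite /same_hypersurface (inj_eq sign_poly_inj) eq_sym -eqr_oppLR -sign_polyN.
by rewrite (inj_eq sign_poly_inj) [opp_signs s == t]eq_sym.
Qed.

Lemma card_monomial d n : #|monomial d n| = 'C(n + d, d).
Proof.
rewrite addnC -size_basis cardE -(size_map (fun m : monomial d n => bmnm (val m))).
apply/perm_size/uniq_perm; last 1 first.
- move=> m; rewrite -basis_cover; apply/mapP/eqP => [[k _ ->]|hm].
    exact/eqP/(valP k).
  have hb : (mdeg m < d.+1)%N by rewrite hm.
  have hk : mdeg (BMultinom hb) == d by apply/eqP.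
  by exists (Sub (BMultinom hb) hk : monomial d n); rewrite ?mem_enum.
- rewrite map_inj_uniq ?enum_uniq // => k l e; exact/val_inj/val_inj.
- exact: uniq_basis.
Qed.

Lemma opp_signsK {d n} : involutive (@opp_signs d n).
Proof. by move=> s; apply/ffunP => m; rewrite !ffunE negbK. Qed.

Lemma same_hypersurface_equiv {d n} :
  {in [set: signs d n] & &, equivalence_rel (@same_hypersurface d n)}.
Proof.
move=> s t u _ _ _; rewrite !same_hypersurfaceE eqxx; split=> //.
case/orP=> /eqP->; rewrite // opp_signsK orbC //.
Qed.

Lemma BB_partition {d n} : partition (BB d n) [set: signs d n].
Proof. exact/equivalence_partitionP/same_hypersurface_equiv. Qed.

Lemma card_BB d n : #|BB d n| = (2 ^ ('C(n + d, d)).-1)%N.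
Proof.
have N0 : (0 < 'C(n + d, d))%N by rewrite bin_gt0 leq_addl.
have /card_uniform_partition/(_ BB_partition) : {in BB d n, forall V : {set signs d n}, #|V| = 2%N}.
  move=> V /imsetP[s _ ->].
  rewrite (_ : [set _ | _ & _] = [set s; opp_signs s]).
    rewrite cards2; suff -> : s != opp_signs s by [].
    have /card_gt0P[m _] : (0 < #|monomial d n|)%N by rewrite card_monomial.
    by apply/eqP => /ffunP/(_ m); rewrite ffunE; case: (s m).
  by apply/setP => t; rewrite !inE same_hypersurfaceE.
rewrite cardsT card_ffun card_bool card_monomial -{1}(prednK N0) expnSr.
by move/eqP; rewrite eqn_pmul2r // => /eqP.
Qed.

(* The zero locus does not depend on the representative s of V; a point of
   P^n(Q) is given by homogeneous coordinates x, not all zero. *)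
Definition has_rational_point (d n : nat) (V : {set signs d n}) : Prop :=
  exists2 s : signs d n, s \in V &
    exists2 x : 'I_n.+1 -> rat, (exists i, x i != 0) &
      meval x (sign_poly s) = 0.

Definition r (R : realType) (d n : nat) : R :=
  #|[set V in BB d n | `[< has_rational_point V >]]|%:R / #|BB d n|%:R.

(* Main.v *)
Require Import Defs.
From mathcomp Require Import all_boot all_order all_algebra.
From mathcomp Require Import boolp reals exp.
From mathcomp Require Import zify ring lra.
From mathcomp Require mpoly.
Import -(notations) mpoly.

(* Fix a set [S] of [d + 1] variables.  At the points with coordinates [+-1] on [S]
   and [0] elsewhere a random polynomial takes a value that is a sum of
   [N = 'C(2 d, d)] random signs, hence vanishes with probability about
   [N ^ (-1/2) ~ d ^ (1/4) / 2 ^ d], and there are about [2 ^ d] such points, so the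
   expected number of zeros on [S] is of order [d ^ (1/4)].  Two values are nearly
   independent, except that they are congruent modulo 4 when the points differ in
   an even number of signs.  Half of the polynomials have values [= 0 mod 4] on [S],
   and a second moment computation restricted to this half shows that all but a
   proportion [O(d ^ (-1/4))] of them have a zero there.

   Now use the [n - d + 1] supports [{0, .., d - 1, d + i}].  The monomial
   [x_(d + i) ^ d] occurs on the [i]-th support only, so the residues modulo 4 are
   independent, and the probability that none of them is [0] is
   [2 ^ (- (n - d + 1)) <= d ^ (- ln 2)]. *)

Set Implicit Arguments.
Unset Strict Implicit.
Unset Printing Implicit Defensive.

Import Order.TTheory GRing.Theory Num.Theory.
Local Open Scope ring_scope.

(** * Probability on sign vectors *)

Section Mean.
Variables (F : realFieldType) (T : finType).
Implicit Types (f g : T -> F) (P Q : pred T).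

Definition mean f : F := (\sum_t f t) / #|T|%:R.
Definition prob P : F := mean (fun t => (P t)%:R).

Lemma eq_mean f g : f =1 g -> mean f = mean g.
Proof. by move=> fg; congr (_ / _); apply: eq_bigr => t _. Qed.

Lemma eq_prob P Q : P =1 Q -> prob P = prob Q.
Proof. by move=> PQ; apply: eq_mean => t; rewrite PQ. Qed.

Lemma meanD f g : mean (fun t => f t + g t) = mean f + mean g.
Proof. by rewrite /mean big_split mulrDl. Qed.

Lemma meanZ c f : mean (fun t => c * f t) = c * mean f.
Proof. by rewrite /mean -mulr_sumr mulrA. Qed.

Lemma mean_sum (J : Type) (r : seq J) (A : pred J) (f : J -> T -> F) :
  mean (fun t => \sum_(j <- r | A j) f j t) = \sum_(j <- r | A j) mean (f j).
Proof. by rewrite /mean exchange_big mulr_suml. Qed.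

Lemma le_mean f g : (forall t, f t <= g t) -> mean f <= mean g.
Proof. by move=> fg; rewrite ler_wpM2r ?invr_ge0 ?ler_sum. Qed.

Lemma mean_reindex (h : T -> T) f : injective h -> mean (f \o h) = mean f.
Proof. by move=> hI; rewrite /mean [in RHS](reindex_inj hI). Qed.

Lemma prob_pred0 P : (forall t, ~~ P t) -> prob P = 0.
Proof.
by move=> P0; rewrite /prob /mean big1 ?mul0r // => t _; rewrite (negbTE (P0 t)).
Qed.

Lemma prob_split P Q :
  prob P = prob (fun t => P t && Q t) + prob (fun t => P t && ~~ Q t).
Proof.
rewrite -meanD; apply: eq_mean => t.
by case: (P t); case: (Q t); rewrite /= ?addr0 ?add0r.
Qed.

(* Chebyshev's inequality on [G] for the number [W] of events [Z j] that occur: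
   conditionally on [G], [W] has mean [2 * e]. *)
Lemma second_moment (J : finType) (X : {set J}) (Z : J -> pred T) (G : pred T)
    (w b : F) (e := #|X|%:R * w) :
  0 < e -> prob G = 1 / 2 -> (forall j t, j \in X -> Z j t -> G t) ->
  (forall j, j \in X -> prob (Z j) = w) ->
  \sum_(j in X) \sum_(k in X) prob (fun t => Z j t && Z k t)
    <= e + 2 * e ^+ 2 + b ->
  prob (fun t => G t && ~~ [exists j in X, Z j t]) <= 1 / (4 * e) + b / (4 * e ^+ 2).
Proof.
move=> e0 G2 ZG Zw le_b.
pose W t : F := \sum_(j in X) (Z j t)%:R.
have mW : mean W = e.
  rewrite /W mean_sum (eq_bigr (fun=> w)); last by move=> j jX; exact: Zw.
  by rewrite sumr_const -mulr_natl.
have mW2 : mean (fun t => W t ^+ 2) <= e + 2 * e ^+ 2 + b.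
  apply: le_trans le_b; rewrite le_eqVlt; apply/orP; left; apply/eqP.
  rewrite (eq_mean (g := fun t => \sum_(j in X) \sum_(k in X) (Z j t && Z k t)%:R)).
    by rewrite mean_sum; apply: eq_bigr => j _; rewrite mean_sum.
  move=> t; rewrite expr2 mulr_suml; apply: eq_bigr => j _.
  by rewrite mulr_sumr; apply: eq_bigr => k _; rewrite -natrM mulnb.
(* On [G] the right side is [(W - 2 * e) ^+ 2]; off [G] both sides vanish. The mean of the right
   side is at most [e + b]. *)
have key : mean (fun t => 4 * e ^+ 2 * (G t && ~~ [exists j in X, Z j t])%:R)
    <= mean (fun t => W t ^+ 2 + ((- (4 * e)) * W t + 4 * e ^+ 2 * (G t)%:R)).
  apply: le_mean => t; have W_0 : ~~ [exists j in X, Z j t] -> W t = 0.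
    move=> /existsPn nZ; apply: big1 => j jX.
    by have := nZ j; rewrite jX /= => /negbTE ->.
  case: (boolP [exists j in X, Z j t]) => [/exists_inP[j jX Zj]|nZ].
    rewrite (ZG j t jX Zj) andbF mulr0 mulr1.
    by rewrite (_ : _ + _ = (W t - 2 * e) ^+ 2) ?sqr_ge0 //; ring.
  by rewrite W_0 // andbT; lra.
have Gm : mean (fun t => (G t)%:R) = 1 / 2 := G2.
rewrite meanZ !meanD !meanZ mW Gm in key.
have e40 : 0 < 4 * e ^+ 2 by rewrite mulr_gt0 // exprn_gt0.
rewrite -(ler_pM2l e40) (_ : _ * (_ + _) = e + b); last first.
  by field; rewrite gt_eqF.
by apply: (le_trans key); lra.
Qed.

End Mean.

Section Signs.
Variables (F : realFieldType) (M : finType).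
Local Notation Omega := {ffun M -> bool}.
Implicit Types (s : Omega) (A B D : {set M}) (H : pred Omega).
Local Notation Pr := (@prob F {ffun M -> bool}).

Definition shift (c : M -> bool) s : Omega := [ffun m => s m (+) c m].
Definition flip (m : M) := shift (pred1 m).
Definition cnt D s : nat := \sum_(m in D) s m.

Lemma shiftK c : involutive (shift c).
Proof. by move=> s; apply/ffunP => m; rewrite !ffunE addbK. Qed.

Lemma prob_shift c H : Pr (H \o shift c) = Pr H.
Proof. exact/(mean_reindex (fun s => (H s)%:R))/inv_inj/shiftK. Qed.

Lemma prob_predT : Pr predT = 1.
Proof.
rewrite /prob /mean sumr_const divff // pnatr_eq0 -lt0n.
by apply/card_gt0P; exists [ffun=> false].
Qed.

(** Flipping [m] pairs the vectors of [H] where [Q] holds with those where it fails. *)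
Lemma prob_toggle (Q H : pred Omega) m :
  (forall s, Q (flip m s) = ~~ Q s) -> (forall s, H (flip m s) = H s) ->
  Pr (fun s => H s && Q s) = Pr H / 2.
Proof.
move=> Qm Hm.
have e : Pr (fun s => H s && ~~ Q s) = Pr (fun s => H s && Q s).
  rewrite -(prob_shift (pred1 m)); apply: eq_prob => s /=.
  by rewrite -/(flip m s) Qm Hm negbK.
by rewrite (prob_split F H Q) e; field.
Qed.

Lemma cnt_flip_out D m s : m \notin D -> cnt D (flip m s) = cnt D s.
Proof.
move=> mD; apply: eq_bigr => k kD; rewrite ffunE /=.
by case: eqP => [km|]; rewrite ?addbF //; rewrite -km kD in mD.
Qed.

Lemma odd_cnt_flip D m s : m \in D -> odd (cnt D (flip m s)) = ~~ odd (cnt D s).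
Proof.
move=> mD; rewrite /cnt !(big_setD1 m mD) /= -!/(cnt _ _) !oddD.
rewrite cnt_flip_out ?inE ?eqxx // ffunE /= eqxx addbT !oddb.
by rewrite addNb.
Qed.

(** As [H] ignores the signs on [A], these stay uniform given [H] and the count is binomial. The
    induction removes one element of [A]; its two cases add up by Pascal's rule. *)
Lemma prob_cnt A k H :
  (forall m s, m \in A -> H (flip m s) = H s) ->
  Pr (fun s => H s && (cnt A s == k)) = 'C(#|A|, k)%:R / 2 ^+ #|A| * Pr H.
Proof.
elim: {A}#|A| {-2}A (erefl #|A|) k H => [|n IH] A nA k H Hinv.
  rewrite (cards0_eq nA) cards0 expr0 divr1 bin0n.
  case: k => [|k]; rewrite /= ?mul1r ?mul0r.
    by apply: eq_prob => s; rewrite /cnt big_set0 eqxx andbT.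
  by apply: prob_pred0 => s; rewrite /cnt big_set0 andbF.
have /card_gt0P[m mA] : (0 < #|A|)%N by rewrite nA.
have nA' : #|A :\ m| = n by move: nA; rewrite (cardsD1 m) mA => -[].
have mA' : m \notin A :\ m by rewrite !inE eqxx.
have cntA s : cnt A s = (s m + cnt (A :\ m) s)%N by rewrite /cnt (big_setD1 m).
have Hinv' j s : j \in A :\ m -> H (flip j s) = H s.
  by rewrite inE => /andP[_]; exact: Hinv.
rewrite (prob_split F _ (fun s => s m)).
have step l : Pr (fun s => H s && (cnt (A :\ m) s == l) && s m)
  = 'C(n, l)%:R / 2 ^+ n * Pr H / 2.
  rewrite (@prob_toggle (fun s => s m) (fun s => H s && (cnt (A :\ m) s == l)) m).
  - by rewrite IH ?nA'.
  - by move=> s; rewrite ffunE /= eqxx addbT.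
  - by move=> s; rewrite Hinv // cnt_flip_out.
have stepN l : Pr (fun s => H s && (cnt (A :\ m) s == l) && ~~ s m)
  = 'C(n, l)%:R / 2 ^+ n * Pr H / 2.
  rewrite (@prob_toggle (fun s => ~~ s m) (fun s => H s && (cnt (A :\ m) s == l)) m).
  - by rewrite IH ?nA'.
  - by move=> s; rewrite ffunE /= eqxx addbT.
  - by move=> s; rewrite Hinv // cnt_flip_out.
rewrite [X in _ + X](_ : _ = 'C(n, k)%:R / 2 ^+ n * Pr H / 2); last first.
  rewrite -stepN; apply: eq_prob => s; rewrite cntA.
  by case: (s m); rewrite ?andbF.
have p2 : (2 : F) ^+ n != 0 by rewrite expf_neq0 // pnatr_eq0.
case: k => [|k].
  rewrite [X in X + _](_ : _ = 0); last first.
    by apply: prob_pred0 => s; rewrite cntA; case: (s m); rewrite ?andbF.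
  by rewrite nA !bin0 exprS; field.
rewrite [X in X + _](_ : _ = 'C(n, k)%:R / 2 ^+ n * Pr H / 2); last first.
  rewrite -step; apply: eq_prob => s; rewrite cntA.
  by case: (s m); rewrite ?andbF.
by rewrite nA binS natrD exprS; field.
Qed.

End Signs.

(** * Estimates for central binomial probabilities *)

Section CentralBinomial.
Variable F : realFieldType.
Implicit Types (m n : nat).

(* The probability that a sum of [2 * m] independent random signs vanishes. *)
Definition pbal m : F := 'C(m.*2, m)%:R / 4 ^+ m.

Lemma pbal_gt0 m : 0 < pbal m.
Proof. by rewrite divr_gt0 ?exprn_gt0 // ltr0n bin_gt0 -addnn leq_addr. Qed.

Lemma pbalS m : pbal m.+1 = pbal m * ((2 * m%:R + 1) / (2 * m%:R + 2)).
Proof.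
have e1 : (m.+1 * 'C(m.*2.+2, m.+1) = 2 * m.*2.+1 * 'C(m.*2, m))%N.
  have d1 := mul_bin_diag m.*2.+2 m; have d2 := mul_bin_diag m.*2.+1 m.
  have d3 : 'C(m.*2.+1, m) = 'C(m.*2.+1, m.+1).
    by rewrite -bin_sub; [congr 'C(_, _)|]; lia.
  by rewrite /= d3 in d1 d2; nia.
have m1 : m%:R + 1 != 0 :> F by rewrite natr1 pnatr_eq0.
rewrite /pbal doubleS; move: e1; set c := 'C(_, m.+1); set c' := 'C(_, m) => e1.
have e2 : (m%:R + 1) * c%:R = 2 * (2 * m%:R + 1) * c'%:R :> F.
  have := congr1 (fun k => k%:R : F) e1; rewrite !natrM -natr1 => ->.
  by rewrite -mul2n -[in RHS](natrM _ 2 m) natr1.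
have -> : c%:R = 2 * (2 * m%:R + 1) * c'%:R / (m%:R + 1) :> F by rewrite -e2; field.
rewrite exprS; field.
have -> : 2 * m%:R + 2 = 2 * (m%:R + 1) :> F by ring.
by rewrite m1 mulf_neq0 ?expf_neq0 ?pnatr_eq0.
Qed.

(** One step up replaces the factor [m] by [(m + 1) ((2 m + 1) / (2 m + 2)) ^ 2 = m + 1 / (4 (m +
    1))]. *)
Lemma mulr_pbal_sqr_homo m n : (m <= n)%N -> m%:R * pbal m ^+ 2 <= n%:R * pbal n ^+ 2.
Proof.
move=> /subnKC <-; elim: (n - m)%N => [|k IH]; first by rewrite addn0.
apply: le_trans IH _; rewrite addnS pbalS -natr1.
set x := (m + k)%:R; have x0 : 0 <= x :> F by [].
move: (pbal _) => y; rewrite exprMn; move: (y ^+ 2) (sqr_ge0 y) => z z0.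
rewrite mulrCA [leLHS]mulrC ler_wpM2l //.
rewrite (_ : (x + 1) * _ = x + 1 / (4 * (x + 1))); last by field; lra.
by rewrite lerDl divr_ge0 //; lra.
Qed.

Lemma pbal_sqr_ge m : (0 < m)%N -> 1 / 4 <= m%:R * pbal m ^+ 2.
Proof.
move=> /mulr_pbal_sqr_homo; apply: le_trans.
by rewrite /pbal /= (_ : 'C(2, 1) = 2%N) //; lra.
Qed.

(** The left side equals 1 at [m = 0] and decreases, since [(2 m + 3) (2 m + 1) < (2 m + 2) ^ 2]. *)
Lemma pbal_sqr_le m : (2 * m%:R + 1) * pbal m ^+ 2 <= 1.
Proof.
elim: m => [|m IH]; first by rewrite /pbal bin0 expr0; lra.
apply: le_trans IH; rewrite pbalS -[m.+1%:R]natr1.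
set x := m%:R; have x0 : 0 <= x :> F by [].
move: (pbal _) => y; rewrite exprMn; move: (y ^+ 2) (sqr_ge0 y) => z z0.
rewrite mulrCA [leRHS]mulrC ler_wpM2l //.
rewrite (_ : (2 * (x + 1) + 1) * _ = 2 * x + 1 - (2 * x + 1) / (2 * x + 2) ^+ 2).
  by rewrite gerBl divr_ge0 ?sqr_ge0 //; lra.
by field; lra.
Qed.

(** Since [pbal k] is about [(pi k) ^ (-1/2)], the product is close to [2 * pbal (a + b) ^+ 2] when
    [a] and [b] are close; the 2 reflects the congruence modulo 4. The bound combines the
    monotonicity of [m * pbal m ^+ 2] with [4 a b = (a + b) ^ 2 (1 - u)]. *)
Lemma pbal_mul_le a b (u := ((a%:R - b%:R) / (a + b)%:R) ^+ 2 : F) :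
  (0 < a + b)%N -> u <= 1 / 4 -> pbal a * pbal b <= 2 * pbal (a + b) ^+ 2 * (1 + u).
Proof.
move=> ab0 u4; set k : F := (a + b)%:R.
have k0 : 0 < k :> F by rewrite ltr0n.
have u0 : 0 <= u by rewrite sqr_ge0.
have wa := pbal_gt0 a; have wb := pbal_gt0 b; have wk := pbal_gt0 (a + b).
have eab : 4 * (a%:R * b%:R) = k ^+ 2 * (1 - u).
  have e (x y : F) : y != 0 -> y ^+ 2 * (1 - (x / y) ^+ 2) = y ^+ 2 - x ^+ 2.
    by move=> y0; field.
  by rewrite e ?gt_eqF // /k natrD; ring.
have la := mulr_pbal_sqr_homo (leq_addr b a); have lb := mulr_pbal_sqr_homo (leq_addl a b).
rewrite -/k in la lb; clearbody u k.
have lab : a%:R * b%:R * (pbal a * pbal b) ^+ 2 <= k ^+ 2 * (pbal (a + b) ^+ 2) ^+ 2.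
  rewrite (_ : _ * _ = (a%:R * pbal a ^+ 2) * (b%:R * pbal b ^+ 2)); last by ring.
  rewrite (_ : k ^+ 2 * _ = (k * pbal (a + b) ^+ 2) * (k * pbal (a + b) ^+ 2)); last by ring.
  by apply: ler_pM => //; rewrite mulr_ge0 // sqr_ge0.
have lu : (1 - u) * (pbal a * pbal b) ^+ 2 <= 4 * (pbal (a + b) ^+ 2) ^+ 2.
  rewrite -(ler_pM2l (exprn_gt0 2 k0)) mulrA -eab.
  by rewrite [leRHS]mulrCA -mulrA ler_pM2l.
have p0 : 0 <= 2 * pbal (a + b) ^+ 2 * (1 + u).
  by apply: mulr_ge0; [rewrite mulr_ge0 ?sqr_ge0|lra].
have q0 : 0 <= pbal a * pbal b by rewrite mulr_ge0 // ltW.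
rewrite -ler_sqr //.
have u1 : 0 < 1 - u by lra.
rewrite -(ler_pM2l u1); apply: (le_trans lu).
set z := pbal (a + b) ^+ 2.
(* What remains is [(1 - u) (1 + u) ^ 2 >= 1], true for [u <= 1 / 4]. *)
rewrite (_ : (1 - u) * _ = 4 * z ^+ 2 + 4 * z ^+ 2 * (u * (1 - u - u ^+ 2))); last by ring.
have u2 : u * u <= 1 / 4 * u by rewrite ler_wpM2r.
rewrite lerDl; apply: mulr_ge0; first by rewrite mulr_ge0 ?sqr_ge0.
by apply: mulr_ge0 => //; rewrite expr2; lra.
Qed.

End CentralBinomial.

(** * Joint vanishing of two sign sums, and independent attempts *)

Section Zeros.
Variables (F : realFieldType) (M : finType).
Local Notation Pr := (@prob F {ffun M -> bool}).

Lemma prob_cnt_half (D : {set M}) K c :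
  #|D| = K.*2 -> Pr (fun s => cnt D (shift c s) == K) = pbal F K.
Proof.
move=> DK; rewrite (prob_shift _ c (fun s => cnt D s == K)).
rewrite (prob_cnt F K (H := predT)) // prob_predT DK mulr1 /pbal.
by rewrite -mul2n exprM -natrX.
Qed.

(** Let [B] be the set where [c] and [c'] disagree. After undoing [c], the counts are [x + y] and
    [(2 b - x) + y], with [x] counted on [B] and [y] on the rest. Both equal [a + b] iff [x = b] and
    [y = a], two independent events. *)
Lemma prob_cnt_half2 (D : {set M}) a b (c c' : M -> bool) :
  #|D| = (a + b).*2 -> #|[set m in D | c m (+) c' m]| = b.*2 ->
  Pr (fun s => (cnt D (shift c s) == a + b)%N && (cnt D (shift c' s) == a + b)%N)
    = pbal F a * pbal F b.
Proof.
set B := [set _ in D | _] => DK Bb; pose A := D :\: B.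
have sBD : B \subset D by apply/subsetP => m; rewrite inE => /andP[].
have Aa : #|A| = a.*2 by rewrite cardsDS // DK Bb; lia.
have shA m s : m \in A -> cnt B (flip m s) = cnt B s.
  by rewrite inE => /andP[mB _]; exact: cnt_flip_out.
rewrite -[LHS](prob_shift _ c).
rewrite (@eq_prob _ _ _ (fun s => (cnt B s == b) && (cnt A s == a))); last first.
  move=> s /=; rewrite shiftK.
  have cD t : cnt D t = (cnt B t + cnt A t)%N.
    by rewrite /cnt (big_setID B) (setIidPr sBD).
  have -> : shift c' (shift c s) = shift (fun m => c m (+) c' m) s.
    by apply/ffunP => m; rewrite !ffunE addbA.
  have -> : cnt D (shift (fun m => c m (+) c' m) s) = (b.*2 - cnt B s + cnt A s)%N.
    rewrite cD; congr (_ + _)%N.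
      apply/eqP; rewrite -(eqn_add2r (cnt B s)) subnK; last first.
        by rewrite -Bb -sum1_card leq_sum // => m _; case: (s m).
      rewrite -Bb -sum1_card /cnt -big_split /=; apply/eqP/eq_bigr => m.
      by rewrite inE => /andP[_ cm]; rewrite ffunE cm; case: (s m).
    apply: eq_bigr => m; rewrite !inE => /andP[+ mD]; rewrite mD ffunE /= => /negbTE ->.
    by rewrite addbF.
  rewrite cD; have : (cnt B s <= b.*2)%N.
    by rewrite -Bb -sum1_card leq_sum // => m _; case: (s m).
  by lia.
rewrite prob_cnt; last by move=> m s /shA ->.
rewrite (prob_cnt F b (H := predT)) // prob_predT Aa Bb mulr1 /pbal.
by rewrite -!mul2n !exprM -!natrX.
Qed.

(* Decompose according to the first [i] with [G i]: the flips of the [m j] show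
   that the events [G j] are independent of [G i] and [E i] for [j < i]. *)
Lemma prob_no_success k (G E : nat -> pred {ffun M -> bool}) (m : nat -> M) (q : F) :
  0 <= q ->
  (forall i s, (i < k)%N -> G i (flip (m i) s) = ~~ G i s) ->
  (forall i j s, (i < k)%N -> (j < k)%N -> i != j -> G j (flip (m i) s) = G j s) ->
  (forall i j s, (i < k)%N -> (j < k)%N -> i != j -> E j (flip (m i) s) = E j s) ->
  (forall i, (i < k)%N -> Pr (fun s => G i s && ~~ E i s) <= q) ->
  Pr (fun s => all (fun i => ~~ E i s) (iota 0 k)) <= 1 / 2 ^+ k + 2 * q.
Proof.
move=> q0 Gm Ginv Einv GEq.
pose noG j s := all (fun i => ~~ G i s) (iota 0 j).
pose noE j s := all (fun i => ~~ E i s) (iota 0 j).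
have iotaS j : iota 0 j.+1 = rcons (iota 0 j) j by rewrite -cats1 -addn1 iotaD.
have noGinv i j s : (i < k)%N -> (j <= i)%N -> noG j (flip (m i) s) = noG j s.
  move=> ik ji; apply: eq_in_all => l; rewrite mem_iota => /andP[_ lj].
  by rewrite Ginv //; lia.
have indep j H : (j <= k)%N ->
    (forall i s, (i < j)%N -> H (flip (m i) s) = H s) ->
    Pr (fun s => H s && noG j s) = Pr H / 2 ^+ j.
  elim: j => [|j IH] jk Hinv.
    by rewrite expr0 divr1; apply: eq_prob => s; rewrite andbT.
  rewrite (@eq_prob _ _ _ (fun s => (H s && noG j s) && ~~ G j s)); last first.
    by move=> s; rewrite /noG iotaS all_rcons; case: (H s); rewrite //= andbC.
  rewrite (@prob_toggle _ _ (fun s => ~~ G j s) (fun s => H s && noG j s) (m j)).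
  - rewrite IH ?(ltnW jk) //; last by move=> i s ij; rewrite Hinv // ltnW.
    by rewrite exprSr invfM mulrA.
  - by move=> s; rewrite Gm.
  - by move=> s; rewrite Hinv // noGinv.
have le_sum j s : (noE j s)%:R <=
    (noG j s)%:R + \sum_(i < j) (G i s && ~~ E i s && noG i s)%:R :> F.
  elim: j => [|j IH]; first by rewrite big_ord0 addr0.
  rewrite big_ord_recr /= /noG /noE iotaS !all_rcons -!/(noG _ _) -!/(noE _ _).
  have S0 : 0 <= \sum_(i < j) (G i s && ~~ E i s && noG i s)%:R :> F by apply: sumr_ge0.
  move: IH S0; set S := \sum_(i < j) _ => IH S0.
  by case: (noE j s) IH; case: (noG j s); case: (G j s); case: (E j s) => /=; lra.
apply: (le_trans (le_mean (le_sum k))); rewrite meanD mean_sum.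
have e0 := @indep k predT (leqnn k) (fun _ _ _ => erefl); rewrite prob_predT in e0.
rewrite -[mean _]/(Pr (fun s => predT s && noG k s)) e0 lerD2l.
apply: (@le_trans _ _ (\sum_(i < k) q / 2 ^+ i)).
  apply: ler_sum => i _; rewrite -[mean _]/(Pr (fun s => (G i s && ~~ E i s) && noG i s)).
  rewrite indep ?(ltnW (ltn_ord i)) //; last first.
    by move=> j s ji; rewrite Ginv ?Einv //; try (move: (ltn_ord i); lia).
  by rewrite ler_wpM2r ?invr_ge0 ?exprn_ge0 // GEq.
rewrite (_ : \sum_(i < k) q / 2 ^+ i = 2 * q - 2 * q / 2 ^+ k).
  by rewrite gerBl divr_ge0 ?exprn_ge0 // mulr_ge0.
elim: (k) => [|j IH]; first by rewrite big_ord0 expr0; lra.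
by rewrite big_ord_recr /= IH exprS; field; rewrite expf_neq0 ?pnatr_eq0.
Qed.

End Zeros.

(** * Values at points with coordinates in {-1, 0, 1} *)

Section TruncatedGeometric.
Variable d : nat.
Implicit Types (p q : {poly int}) (x : int).

(** The series [1 / (1 - x X)] cut off after degree [d]; the cut does not affect coefficients of
    products in degrees up to [d]. *)
Definition geom x : {poly int} := \poly_(e < d.+1) (x ^+ e).

Lemma coef_geom x k : (k <= d)%N -> (geom x)`_k = x ^+ k.
Proof. by move=> kd; rewrite coef_poly ltnS kd. Qed.

Lemma geom0 : geom 0 = 1.
Proof.
apply/polyP => k; rewrite coef_poly coef1 expr0n.
by case: k => [|k] //=; case: ifP.
Qed.

(* Writing [geom 1 = E + O] with [E] even and [O] odd, [geom (-1) = E - O] and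
   the difference of the squares is [4 * E * O]. *)
Lemma geom_sqr_mod4 : exists r, geom 1 ^+ 2 = geom (- 1) ^+ 2 + r *+ 4.
Proof.
pose o : {poly int} := \poly_(e < d.+1) (odd e)%:R.
have -> : geom (- 1) = geom 1 - o *+ 2.
  apply/polyP => k; rewrite coefB coefMn !coef_poly expr1n -signr_odd.
  by case: ifP => // _; case: (odd k).
by exists (o * (geom 1 - o)); ring.
Qed.

Lemma geom_exp_mod4 t :
  ~~ odd t -> exists r, geom 1 ^+ t = geom (- 1) ^+ t + r *+ 4.
Proof.
move=> /even_halfK <-; rewrite -mul2n !exprM; have [r ->] := geom_sqr_mod4.
move: (geom (- 1) ^+ 2) => G.
elim: (t./2) => [|k [r' IH]]; first by exists 0; rewrite mul0rn addr0.
exists (r * G ^+ k + r' * (G + r *+ 4)).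
by rewrite !exprS IH; ring.
Qed.

(** These are the coefficients of [(1 - X) ^ (- (k + 1))]; the inner induction sums a diagonal of
    Pascal's triangle. *)
Lemma coef_geom1_exp k j : (j <= d)%N -> (geom 1 ^+ k.+1)`_j = 'C(k + j, j)%:R.
Proof.
elim: k j => [|k IH] j jd; first by rewrite expr1 coef_geom // expr1n binn.
rewrite exprSr coefM.
rewrite (eq_bigr (fun i : 'I_j.+1 => 'C(k + i, i)%:R)); last first.
  by move=> i _; rewrite coef_geom ?expr1n ?mulr1 ?IH //; have := ltn_ord i; lia.
elim: j {jd} => [|j IHj]; first by rewrite big_ord_recl big_ord0 !bin0 addr0.
by rewrite big_ord_recr /= IHj -natrD addSn !addnS binS addnC.
Qed.

Definition coef_dominated p q := forall k, (k <= d)%N -> `|p`_k| <= q`_k.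

Lemma coef_dominatedM p p' q q' : coef_dominated p q -> coef_dominated p' q' ->
  coef_dominated (p * p') (q * q').
Proof.
move=> pq pq' k kd; rewrite !coefM; apply: (le_trans (ler_norm_sum _ _ _)).
apply: ler_sum => i _; have ik := ltn_ord i.
by rewrite normrM ler_pM ?pq ?pq' //; lia.
Qed.

Lemma coef_dominatedX p q n : coef_dominated p q -> coef_dominated (p ^+ n) (q ^+ n).
Proof.
move=> pq; elim: n => [|n IH]; last by rewrite !exprS; exact: coef_dominatedM.
by move=> k _; rewrite !expr0 coef1; case: k.
Qed.

Lemma geom_dominated x : `|x| = 1 -> coef_dominated (geom x) (geom 1).
Proof. by move=> x1 k kd; rewrite !coef_geom // normrX x1. Qed.

(** Up to degree [d] the product is [1 / (1 - X ^ 2)], with coefficients 0 and 1. *)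
Lemma geom_mulN_dominated : coef_dominated (geom (- 1) * geom 1) (geom 1).
Proof.
move=> k kd; rewrite coef_geom // expr1n coefM.
rewrite (eq_bigr (fun i : 'I_k.+1 => (- 1) ^+ i)); last first.
  by move=> i _; rewrite !coef_geom ?expr1n ?mulr1 //; have := ltn_ord i; lia.
suff -> : \sum_(i < k.+1) (- 1) ^+ i = (~~ odd k)%:R :> int by case: (odd k).
elim: k {kd} => [|k IH]; first by rewrite big_ord_recl big_ord0.
by rewrite big_ord_recr /= IH -signr_odd /=; case: (odd k).
Qed.

(** Passing from [j - 1] to [j <= d] multiplies the binomial by [(j + d) / j >= 2]. *)
Lemma double_exp_bin k r : (k + r <= d)%N -> (2 ^ r * 'C(k + d, d) <= 'C(k + r + d, d))%N.
Proof.
elim: r => [|r IH] krd; first by rewrite mul1n addn0.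
rewrite addnS in krd.
rewrite expnS -mulnA; apply: (@leq_trans (2 * 'C(k + r + d, d))).
  by rewrite leq_mul2l IH ?(ltnW krd).
rewrite addnS addSn -(leq_pmul2l (ltn0Sn (k + r))).
have e1 := mul_bin_down (k + r + d).+1 d.
rewrite /= subSn ?leq_addl // addnK in e1.
by rewrite -e1 mulnA; apply: leq_mul => //; lia.
Qed.

(** A pair [geom (- 1) * geom 1] is dominated by a single [geom 1], so the product is dominated by
    [geom 1 ^+ maxn t s]. Each of the [minn t s] factors lost gains a factor 2 by
    [double_exp_bin]. *)
Lemma coef_geom_mul_le t s : (t + s)%N = d.+1 ->
  `|(geom (- 1) ^+ t * geom 1 ^+ s)`_d| *+ (2 ^ minn t s) <= 'C(d.*2, d)%:R.
Proof.
move=> tsd; have dom1 := geom_dominated (normr1 _).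
have dom : coef_dominated (geom (- 1) ^+ t * geom 1 ^+ s) (geom 1 ^+ maxn t s).
  case: (leqP t s) => ts.
    rewrite -{1}(subnKC ts) exprD mulrA -exprMn -{2}(subnKC ts) exprD.
    by apply: coef_dominatedM; apply: coef_dominatedX => //; exact: geom_mulN_dominated.
  rewrite -{1}(subnKC (ltnW ts)) exprD mulrAC -exprMn -{2}(subnKC (ltnW ts)) exprD.
  apply: coef_dominatedM; apply: coef_dominatedX; first exact: geom_mulN_dominated.
  by apply: geom_dominated; rewrite normrN1.
have := dom d (leqnn d); have -> : maxn t s = (maxn t s).-1.+1 by lia.
rewrite coef_geom1_exp // => h.
apply: (@le_trans _ _ ('C((maxn t s).-1 + d, d)%:R *+ 2 ^ minn t s)).
  by rewrite lerMn2r h orbT.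
rewrite -mulr_natr -natrM ler_nat mulnC.
apply: (leq_trans (double_exp_bin _)); first by lia.
by rewrite leq_eqVlt; apply/orP; left; apply/eqP; congr 'C(_, _); lia.
Qed.

End TruncatedGeometric.

(** * Signed sums of monomials at the special points *)

Section Points.
Variables d n : nat.
Implicit Types (m : monomial d n) (S U V : {set 'I_n.+1}).

Definition expo m (i : 'I_n.+1) : nat := bmnm (val m) i.

Lemma expo_sum m : (\sum_i expo m i)%N = d.
Proof. by rewrite -mdegE; exact/eqP/(valP m). Qed.

Lemma expo_le m i : (expo m i <= d)%N.
Proof. by rewrite -[leqRHS](expo_sum m) (bigD1 i) //= leq_addr. Qed.

Lemma expo_inj m m' : expo m =1 expo m' -> m = m'.
Proof. by move=> e; apply/val_inj/val_inj/mnmP. Qed.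

Lemma expo_exists (f : 'I_n.+1 -> nat) :
  (\sum_i f i)%N = d -> exists m, expo m =1 f.
Proof.
move=> fd; pose mf : multinom n.+1 := Multinom [tuple f i | i < n.+1].
have mfE i : mf i = f i by rewrite /mf /fun_of_multinom /= tnth_mktuple.
have dmf : mdeg mf = d by rewrite mdegE -fd; apply: eq_bigr => i _; rewrite mfE.
have hb : (mdeg mf < d.+1)%N by rewrite dmf.
have hk : mdeg (BMultinom hb) == d by rewrite /= dmf.
by exists (Sub (BMultinom hb) hk); move=> i; rewrite /expo /= mfE.
Qed.

(** Both sides are the complete homogeneous symmetric polynomial of degree [d]: expanding the
    product chooses an exponent at most [d] for each variable. *)
Lemma sum_monomial (x : 'I_n.+1 -> int) :
  \sum_m \prod_i x i ^+ expo m i = (\prod_i geom d (x i))`_d.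
Proof.
pose c (f : {ffun 'I_n.+1 -> 'I_d.+1}) := \prod_i x i ^+ f i.
have -> : \prod_i geom d (x i) =
    \sum_(f : {ffun 'I_n.+1 -> 'I_d.+1}) c f *: 'X^(\sum_i f i).
  under eq_bigr do rewrite /geom poly_def.
  rewrite bigA_distr_bigA /=; apply: eq_bigr => f _.
  rewrite /c; elim/big_ind3: _ => [||//]; first by rewrite scale1r.
  by move=> ? ? ? ? ? ? -> ->; rewrite exprD -scalerAl -scalerAr scalerA.
rewrite coef_sum (eq_bigr (fun f : {ffun 'I_n.+1 -> 'I_d.+1} =>
    if (\sum_i f i)%N == d then c f else 0)); last first.
  by move=> f _; rewrite coefZ coefXn eq_sym; case: eqP; rewrite ?mulr1 ?mulr0.
rewrite -big_mkcond /=.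
pose h m : {ffun 'I_n.+1 -> 'I_d.+1} := [ffun i => inord (expo m i)].
have hE m i : h m i = expo m i :> nat by rewrite ffunE inordK // ltnS expo_le.
have hI : injective h.
  by move=> m m' e; apply: expo_inj => i; rewrite -!hE e.
rewrite [RHS](_ : _ = \sum_(f in [set h m | m in setT]) c f).
  rewrite big_imset /=; last by move=> ? ? _ _; exact: hI.
  apply: eq_big => m; rewrite ?inE // => _; apply: eq_bigr => i _.
  by rewrite hE.
apply: eq_bigl => f; apply/eqP/imsetP => [fd|[m _ ->]].
  have [m me] := expo_exists fd; exists m => //.
  by apply/ffunP => i; apply/val_inj; rewrite /= hE me.
by rewrite (eq_bigr (expo m)) ?expo_sum // => i _; rewrite hE.
Qed.

Definition point S U (i : 'I_n.+1) : int := if i \in U then - 1 else (i \in S)%:R.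

Definition monomials_on S := [set m | [forall i, (i \notin S) ==> (expo m i == 0)%N]].

(** For [U] inside [S] and a monomial on [S], this tells whether its value at [point S U] is
    [-1]. *)
Definition odd_on U m := \big[addb/false]_i ((i \in U) && odd (expo m i)).

Lemma prod_point S U m : U \subset S ->
  \prod_i point S U i ^+ expo m i = (m \in monomials_on S)%:R * (- 1) ^+ odd_on U m.
Proof.
move=> US; rewrite inE; case: forallP => [mS|/forallP/forallPn[i]].
  rewrite mul1r /odd_on.
  have -> : forall f : 'I_n.+1 -> bool,
      (- 1) ^+ (\big[addb/false]_i f i) = \prod_i (- 1) ^+ f i :> int.
    move=> f.
    rewrite (big_morph (fun b : bool => (- 1) ^+ b : int) (id1 := 1) (op1 := *%R)) //.
    exact: signr_addb.
  apply: eq_bigr => i _; rewrite /point; have := mS i.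
  case: ifP => iU /=; first by rewrite signr_odd.
  by case: (i \in S) => /= [_|/eqP ->]; rewrite ?expr0 ?expr1n.
rewrite negb_imply => /andP[iS mi]; rewrite mul0r (bigD1 i) //= /point.
rewrite (negbTE iS) ifF ?expr0n ?(negbTE mi) ?mul0r //.
by apply/negbTE; apply: contra iS => /(subsetP US).
Qed.

Lemma prod_geom_point S U : U \subset S ->
  \prod_i geom d (point S U i) = geom d (- 1) ^+ #|U| * geom d 1 ^+ #|S :\: U|.
Proof.
move=> US; rewrite (bigID (mem U)) /=; congr (_ * _).
  by rewrite -prodr_const; apply: eq_bigr => i iU; rewrite /point iU.
rewrite -prodr_const big_mkcond [RHS]big_mkcond; apply: eq_bigr => i _ /=.
rewrite inE /point; case: (i \in U) => //=.
by case: (i \in S); rewrite ?geom0.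
Qed.

Lemma sum_sign_point S U : U \subset S ->
  \sum_(m in monomials_on S) (- 1) ^+ odd_on U m =
  (geom d (- 1) ^+ #|U| * geom d 1 ^+ #|S :\: U|)`_d :> int.
Proof.
move=> US; rewrite -prod_geom_point // -sum_monomial big_mkcond.
apply: eq_bigr => m _; rewrite prod_point //.
by case: (m \in _); rewrite ?mul1r ?mul0r.
Qed.

Lemma odd_on0 m : odd_on set0 m = false.
Proof. by rewrite /odd_on big1 // => i _; rewrite inE. Qed.

Variable S : {set 'I_n.+1}.
Hypothesis cardS : #|S| = d.+1.

Lemma card_monomials_on : #|monomials_on S| = 'C(d.*2, d).
Proof.
have := sum_sign_point (sub0set S).
rewrite (eq_bigr (fun=> 1)); last by move=> m _; rewrite odd_on0.
rewrite sumr_const cards0 expr0 mul1r setD0 cardS coef_geom1_exp // addnn => /eqP.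
by rewrite eqr_nat => /eqP.
Qed.

(** The sum of the monomials at [point S U] is [2 K] minus twice the cardinal to be computed. As
    [#|U|] is even, [geom_exp_mod4] makes it congruent to [2 K] modulo 4, so this cardinal is even;
    [coef_geom_mul_le] makes the sum small, so [a] and [b] are close. *)
Lemma odd_monomials_on U K : U \subset S -> ~~ odd #|U| -> 'C(d.*2, d) = K.*2 ->
  exists a b, [/\ (a + b)%N = K,
    #|[set m in monomials_on S | odd_on U m]| = b.*2 &
    `|a%:Z - b%:Z| *+ 2 ^ minn #|U| #|S :\: U| <= K%:Z].
Proof.
move=> US evU NK; set B := [set _ in _ | _].
have sBD : B \subset monomials_on S by apply/subsetP => m; rewrite inE => /andP[].
have tsd : (#|U| + #|S :\: U| = d.+1)%N.
  by rewrite cardsDS // cardS subnKC // -cardS subset_leq_card.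
set h := (geom d (- 1) ^+ #|U| * geom d 1 ^+ #|S :\: U|)`_d.
have hB : h = (K.*2)%:Z - (#|B|.*2)%:Z.
  rewrite /h -sum_sign_point // (big_setID B) /= (setIidPr sBD).
  rewrite (eq_bigr (fun=> - 1)); last by move=> m; rewrite inE => /andP[_ ->].
  rewrite [X in _ + X](eq_bigr (fun=> 1)); last first.
    by move=> m; rewrite !inE => /andP[+ mD]; rewrite mD /= => /negbTE ->.
  rewrite !sumr_const cardsDS // card_monomials_on NK.
  have : (#|B| <= K.*2)%N by rewrite -NK -card_monomials_on subset_leq_card.
  by rewrite mulNrn !natz; move: #|B| => k; lia.
have [r e4] := geom_exp_mod4 d evU.
have h4 : (K.*2)%:Z = h + (r * geom d 1 ^+ #|S :\: U|)`_d *+ 4.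
  rewrite -NK -coefMn -mulrnAl /h -coefD -mulrDl -e4 -exprD tsd.
  by rewrite coef_geom1_exp // addnn natz.
have BK : (#|B| <= K.*2)%N by rewrite -NK -card_monomials_on subset_leq_card.
move: h4; set c : int := (r * _)`_d; move: hB; move: #|B| BK => N BK hB h4.
(* By [hB] and [h4], [N = 2 * c]. *)
exists (K - `|c|)%N, `|c|%N; split; [lia|lia|].
have := coef_geom_mul_le tsd; rewrite -/h NK natz.
rewrite (_ : h = 2 * ((K - `|c|)%:Z - `|c|%:Z)); last by lia.
by rewrite normrM -mulrnAr; lia.
Qed.

End Points.

(** * Zeros supported on d + 1 variables *)

Section SymmetricDifference.
Variable I : finType.
Implicit Types (U V S : {set I}).

Definition symdiff U V := (U :\: V) :|: (V :\: U).

Lemma in_symdiff U V i : (i \in symdiff U V) = (i \in U) (+) (i \in V).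
Proof. by rewrite !inE; case: (i \in U); case: (i \in V). Qed.

Lemma symdiffK U : involutive (symdiff U).
Proof. by move=> V; apply/setP => i; rewrite !in_symdiff addKb. Qed.

Lemma symdiff_subset U V S : U \subset S -> V \subset S -> symdiff U V \subset S.
Proof. by move=> US VS; rewrite subUset !(subset_trans (subsetDl _ _)). Qed.

Lemma odd_card U : odd #|U| = \big[addb/false]_i (i \in U).
Proof.
rewrite -sum1_card big_mkcond /= (big_morph odd oddD (erefl : odd 0 = false)).
by apply: eq_bigr => i _; case: (i \in U).
Qed.

Lemma odd_card_symdiff U V : odd #|symdiff U V| = odd #|U| (+) odd #|V|.
Proof.
by rewrite !odd_card -big_split; apply: eq_bigr => i _; rewrite in_symdiff.
Qed.

Lemma sum_powerset (F : comPzRingType) S (a b : F) :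
  \sum_(U in powerset S) a ^+ #|U| * b ^+ #|S :\: U| = (a + b) ^+ #|S|.
Proof.
rewrite -prodr_const [RHS]big_mkcond [LHS]big_mkcond /=.
(* Outside [S] the factor is [0 + 1], which kills the subsets not contained in [S]. *)
rewrite [RHS](eq_bigr (fun i => (if i \in S then a else 0) + (if i \in S then b else 1))).
  rewrite bigA_distr; apply: eq_bigr => U _; rewrite inE.
  case: ifP => [US|/negbT /subsetPn[i iU iS]].
    rewrite -!prodr_const [X in X * _]big_mkcond [X in _ * X]big_mkcond -big_split.
    apply: eq_bigr => i _; rewrite !inE; case: ifP => iU /=; last by rewrite mul1r.
    by rewrite (subsetP US _ iU) mulr1.
  by rewrite (bigD1 i) //= iU (negbTE iS) mul0r.
by move=> i _; case: ifP => _; rewrite ?add0r.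
Qed.

Definition even_subsets S := [set U in powerset S | ~~ odd #|U|].

(** Adjoining a fixed [i] of [S] to the odd subsets of [S :\ i] injects all subsets of [S :\ i] into
    the even subsets of [S]. For empty [S] the exponent [0.-1] is 0. *)
Lemma card_even_subsets S : (2 ^ #|S|.-1 <= #|even_subsets S|)%N.
Proof.
have [->|/set0Pn[i iS]] := eqVneq S set0.
  by rewrite cards0 card_gt0; apply/set0Pn; exists set0; rewrite !inE sub0set cards0.
have -> : #|S|.-1 = #|S :\ i| by rewrite (cardsD1 i S) iS.
pose f U := if odd #|U| then i |: U else U.
have fE U j : j != i -> (j \in f U) = (j \in U).
  by move=> ji; rewrite /f; case: ifP => // _; rewrite !inE (negbTE ji).
rewrite -card_powerset -(@card_in_imset _ _ f); last first.
  move=> U V; rewrite !powersetE => /subsetD1P[_ iU] /subsetD1P[_ iV] e.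
  apply/setP => j; have [->|ji] := eqVneq j i; first by rewrite (negbTE iU) (negbTE iV).
  by rewrite -(fE U) // e fE.
apply/subset_leq_card/subsetP => _ /imsetP[U + ->].
rewrite powersetE => /subsetD1P[US iU]; rewrite inE powersetE /f.
case: ifP => [oU|->]; last by rewrite US.
by rewrite subUset sub1set iS US cardsU1 iU /= oU.
Qed.

End SymmetricDifference.

Lemma odd_cnt_shift (M : finType) (D : {set M}) c (s : {ffun M -> bool}) :
  odd (cnt D (shift c s)) = odd (cnt D s) (+) odd #|[set m in D | c m]|.
Proof.
have -> : #|[set m in D | c m]| = (\sum_(m in D) c m)%N.
  rewrite -sum1_card big_mkcond [RHS]big_mkcond; apply: eq_bigr => m _.
  by rewrite inE; case: (m \in D); case: (c m).
rewrite -oddD /cnt -big_split !(big_morph odd oddD (erefl : odd 0 = false)).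
by apply: eq_bigr => m _; rewrite ffunE oddD !oddb.
Qed.

Lemma odd_on_symdiff d n (U V : {set 'I_n.+1}) (m : monomial d n) :
  odd_on (symdiff U V) m = odd_on U m (+) odd_on V m.
Proof.
by rewrite /odd_on -big_split; apply: eq_bigr => i _; rewrite in_symdiff andb_addl.
Qed.

(** * The second moment on one support *)

Section OneSupport.
Variables (F : realFieldType) (d n : nat) (S : {set 'I_n.+1}) (i0 : 'I_n.+1) (K : nat).
Implicit Types U V W : {set 'I_n.+1}.
Hypotheses (d1 : (1 < d)%N) (cardS : #|S| = d.+1) (i0S : i0 \in S).
Hypothesis NK : 'C(d.*2, d) = K.*2.
Local Notation Pr := (@prob F {ffun monomial d n -> bool}).
Local Notation D := (monomials_on d S).

(* Restricting to even sets of sign changes makes all the values of a given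
   polynomial congruent modulo 4; avoiding [i0] selects one of the two
   representatives of each projective point. *)
Definition sign_changes := even_subsets (S :\ i0).

(** The value at [point S U] is a sum of [2 K] signs, zero exactly when [K] of them are [-1]. *)
Definition vanishes_at (U : {set 'I_n.+1}) (s : {ffun monomial d n -> bool}) :=
  cnt D (shift (@odd_on d n U) s) == K.

(** Says that the value [2 K - 2 * cnt D s] at [point S set0] is divisible by 4. *)
Definition good_mod4 (s : {ffun monomial d n -> bool}) := odd (cnt D s) == odd K.

Lemma half_bin_gt0 : (0 < K)%N.
Proof. by rewrite -double_gt0 -NK bin_gt0 -addnn leq_addr. Qed.

Lemma sign_changesP U :
  reflect [/\ U \subset S, i0 \notin U & ~~ odd #|U|] (U \in sign_changes).
Proof.
rewrite inE powersetE; apply: (iffP andP) => [[/subsetD1P[]]|[? ? ?]] //.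
by split=> //; apply/subsetD1P.
Qed.

Lemma vanishes_good U s : U \in sign_changes -> vanishes_at U s -> good_mod4 s.
Proof.
move=> /sign_changesP[US _ evU] /eqP zU; rewrite /good_mod4 -zU odd_cnt_shift.
have [a [b [_ -> _]]] := odd_monomials_on cardS US evU NK.
by rewrite odd_double addbF.
Qed.

Lemma good_mod4_toggle m s :
  m \in D -> good_mod4 (flip m s) = ~~ good_mod4 s.
Proof. by move=> mD; rewrite /good_mod4 odd_cnt_flip //; case: odd; case: odd. Qed.

Lemma prob_good_mod4 : Pr good_mod4 = 1 / 2.
Proof.
have /card_gt0P[m mD] : (0 < #|D|)%N.
  by rewrite card_monomials_on // NK double_gt0 half_bin_gt0.
have := @prob_toggle F _ good_mod4 predT m; rewrite prob_predT => <- //.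
by move=> s; exact: good_mod4_toggle.
Qed.

Lemma prob_vanishes U : Pr (vanishes_at U) = pbal F K.
Proof. by rewrite prob_cnt_half // card_monomials_on. Qed.

(** An upper bound for [(1 / 4) ^+ minn #|W| #|S :\: W|] in a form that [sum_powerset] can sum over
    all [W]. *)
Let phi (W : {set 'I_n.+1}) : F :=
  (1 / 4) ^+ #|W| * 1 ^+ #|S :\: W| + 1 ^+ #|W| * (1 / 4) ^+ #|S :\: W|.

(** The signs at the two points differ on [2 b] monomials and agree on [2 a], where
    [odd_monomials_on] for the symmetric difference makes [a] and [b] close, as [pbal_mul_le]
    needs. *)
Lemma prob_vanishes2 U V : U \in sign_changes -> V \in sign_changes -> U != V ->
  Pr (fun s => vanishes_at U s && vanishes_at V s)
    <= 2 * pbal F K ^+ 2 * (1 + phi (symdiff U V)).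
Proof.
move=> /sign_changesP[US iU evU] /sign_changesP[VS iV evV] UV.
set W := symdiff U V.
have WS : W \subset S by exact: symdiff_subset.
have evW : ~~ odd #|W| by rewrite odd_card_symdiff (negbTE evU) (negbTE evV).
have [a [b [abK Bb dab]]] := odd_monomials_on cardS WS evW NK.
have K0 : 0 < K%:R :> F by rewrite ltr0n half_bin_gt0.
rewrite /vanishes_at -abK (@prob_cnt_half2 F _ _ a b); last 2 first.
- by rewrite card_monomials_on // NK abK.
- by rewrite -Bb; apply: eq_card => m; rewrite !inE odd_on_symdiff.
set mn := minn _ _ in dab.
(* [W] is nonempty as [U != V], and [i0] lies in [S :\: W]. *)
have mn0 : (0 < mn)%N.
  rewrite leq_min !card_gt0; apply/andP; split.
    apply: contra UV => /eqP W0; rewrite -(symdiffK U V) -/W W0; apply/eqP/setP => i.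
    by rewrite in_symdiff inE addbF.
  apply/set0Pn; exists i0; rewrite inE i0S andbT in_symdiff.
  by rewrite (negbTE iU) (negbTE iV).
set u := ((a%:R - b%:R) / (a + b)%:R) ^+ 2 : F.
have ule : u <= (1 / 4) ^+ mn.
  have dabF : `|a%:R - b%:R| * 2 ^+ mn <= K%:R :> F.
    have : (`|a%:Z - b%:Z| *+ 2 ^ mn)%:~R <= K%:~R :> F by rewrite ler_int.
    by rewrite rmorphMn /= intr_norm rmorphB /= -mulr_natr natrX.
  rewrite (_ : 1 / 4 = (1 / 2) ^+ 2); last by field.
  rewrite exprAC /u abK -[leLHS]real_normK ?num_real //.
  rewrite lerXn2r ?nnegrE ?normr_ge0 ?exprn_ge0 ?divr_ge0 //.
  rewrite normrM normfV (gtr0_norm K0) ler_pdivrMr // mul1r exprVn.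
  by rewrite mulrC ler_pdivlMr ?exprn_gt0.
have phi_ge : (1 / 4) ^+ mn <= phi W.
  rewrite /phi !expr1n mulr1 !mul1r /mn /minn; case: ifP => _.
    by rewrite lerDl exprn_ge0 ?invr_ge0.
  by rewrite lerDr exprn_ge0 ?invr_ge0.
have u4 : u <= 1 / 4.
  apply: (le_trans ule); rewrite -(prednK mn0) exprS.
  by apply: ler_piMr; [lra|apply: exprn_ile1; lra].
apply: (le_trans (pbal_mul_le _ u4)); first by rewrite abK half_bin_gt0.
rewrite -/u; apply: ler_wpM2l; first by apply: mulr_ge0 => //; exact: sqr_ge0.
by rewrite lerD2l; exact: le_trans phi_ge.
Qed.

(** In [second_moment], the errors [phi] add up to at most [2 (5 / 4) ^ (d + 1)] for each [U],
    against at least [2 ^ (d - 1)] points. *)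
Lemma prob_good_not_vanishes (e := #|sign_changes|%:R * pbal F K) :
  Pr (fun s => good_mod4 s && ~~ [exists U in sign_changes, vanishes_at U s])
    <= 1 / (4 * e) + 4 * (5 / 8) ^+ d.+1.
Proof.
set X := sign_changes in e *.
have cardX : (2 ^ d.-1 <= #|X|)%N.
  have := card_even_subsets (S :\ i0).
  by rewrite (_ : #|S :\ i0| = d) //; move: cardS; rewrite (cardsD1 i0) i0S => -[].
have X0 : 0 < #|X|%:R :> F by rewrite ltr0n (leq_trans _ cardX) // expn_gt0.
have w2 : 0 <= 2 * pbal F K ^+ 2 by apply: mulr_ge0 => //; exact: sqr_ge0.
have e0 : 0 < e by rewrite mulr_gt0 // pbal_gt0.
have phi0 W : 0 <= phi W by rewrite addr_ge0 ?mulr_ge0 ?exprn_ge0 ?divr_ge0.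
have sum_phi U : U \in X -> \sum_(V in X) phi (symdiff U V) <= 2 * (5 / 4) ^+ d.+1.
  move=> /sign_changesP[US _ _].
  rewrite (_ : 2 * _ = \sum_(W in powerset S) phi W); last first.
    rewrite /phi big_split /= !sum_powerset cardS.
    by rewrite [1 + _]addrC (_ : 1 / 4 + 1 = 5 / 4) ?mulr_natl ?mulr2n //; field.
  rewrite [leRHS](reindex_inj (inv_inj (symdiffK U))) /=.
  rewrite big_mkcond [leRHS]big_mkcond; apply: ler_sum => V _.
  case: ifP => [/sign_changesP[VS _ _]|_]; last by case: ifP.
  by rewrite powersetE symdiff_subset.
have pair U V : U \in X -> V \in X -> Pr (fun s => vanishes_at U s && vanishes_at V s)
    <= (U == V)%:R * pbal F K + 2 * pbal F K ^+ 2 * (1 + phi (symdiff U V)).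
  move=> UX VX.
  have [<-|UV] := eqVneq U V; last by rewrite mul0r add0r prob_vanishes2.
  rewrite mul1r (@eq_prob _ _ _ (vanishes_at U)) ?prob_vanishes; last first.
    by move=> s; rewrite andbb.
  by rewrite lerDl mulr_ge0 // addr_ge0.
(* The total error [#|X| * 2 w ^ 2 * 2 (5 / 4) ^ (d + 1)], with [w = pbal F K], in terms of
   [e = #|X| * w]. *)
set b := 4 * e ^+ 2 * (5 / 4) ^+ d.+1 / #|X|%:R.
apply: (@le_trans _ _ (1 / (4 * e) + b / (4 * e ^+ 2))).
  apply: (second_moment e0 prob_good_mod4).
  - by move=> U s; exact: vanishes_good.
  - by move=> U _; exact: prob_vanishes.
  apply: (@le_trans _ _ (\sum_(U in X)
    (pbal F K + 2 * pbal F K ^+ 2 * (#|X|%:R + 2 * (5 / 4) ^+ d.+1)))).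
    apply: ler_sum => U UX.
    apply: (@le_trans _ _ (\sum_(V in X) ((U == V)%:R * pbal F K
        + 2 * pbal F K ^+ 2 * (1 + phi (symdiff U V))))).
      by apply: ler_sum => V; exact: pair.
    rewrite big_split /= -mulr_suml -mulr_sumr big_split /= sumr_const.
    rewrite (bigD1 U) //= eqxx big1 ?addr0 ?mul1r; last first.
      by move=> V /andP[_ /negbTE]; rewrite eq_sym => ->.
    by rewrite lerD2l ler_wpM2l // lerD2l sum_phi.
  have alg (x y p : F) : x != 0 ->
      x * (y + 2 * y ^+ 2 * (x + 2 * p)) = x * y + 2 * (x * y) ^+ 2 + 4 * (x * y) ^+ 2 * p / x.
    by move=> x0; field.
  by rewrite sumr_const -[leLHS]mulr_natl /b /e alg ?lexx ?lt0r_neq0.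
rewrite lerD2l (_ : b / _ = (5 / 4) ^+ d.+1 / #|X|%:R); last first.
  have alg (x y p : F) : x != 0 -> y != 0 -> 4 * y ^+ 2 * p / x / (4 * y ^+ 2) = p / x.
    by move=> x0 y0; field; rewrite x0.
  by rewrite /b alg ?lt0r_neq0.
rewrite ler_pdivrMr //.
have -> : (5 / 4) ^+ d.+1 = (5 / 8) ^+ d.+1 * 2 ^+ d.+1 :> F.
  by rewrite -exprMn; congr (_ ^+ _); field.
rewrite [leLHS]mulrC [leRHS]mulrAC; apply: ler_wpM2r.
  by rewrite exprn_ge0 ?divr_ge0.
rewrite -natrX -natrM ler_nat; apply: (@leq_trans (4 * 2 ^ d.-1)).
  by rewrite -{1}(prednK (ltnW d1)) !expnS; lia.
by rewrite leq_mul2l cardX.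
Qed.

(** [pbal_sqr_ge] bounds [pbal F K] below in terms of [K], and [2 K = 4 ^ d * pbal F d] with
    [pbal_sqr_le] bounds [K] above by order [4 ^ d / d ^ (1/2)]. Eliminating [K] gives
    [d <= 64 c ^ 4]. *)
Lemma expected_zeros_ge (t : F) : 0 <= t -> t ^+ 4 <= d%:R ->
  t / 4 <= #|sign_changes|%:R * pbal F K.
Proof.
move=> t0 td; set c : F := 2 ^+ d.-1 * pbal F K.
have c0 : 0 <= c by rewrite mulr_ge0 ?exprn_ge0 // ltW // pbal_gt0.
apply: (@le_trans _ _ c); last first.
  apply: ler_wpM2r; first exact/ltW/pbal_gt0.
  rewrite -natrX ler_nat.
  have := card_even_subsets (S :\ i0).
  by rewrite (_ : #|S :\ i0| = d) //; move: cardS; rewrite (cardsD1 i0) i0S => -[].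
have cw : 1 <= 8 * c ^+ 2 * pbal F d.
  have -> : 8 * c ^+ 2 * pbal F d = 4 * (K%:R * pbal F K ^+ 2).
    have -> : pbal F d = 2 * K%:R / (4 * (2 ^+ d.-1) ^+ 2).
      rewrite /pbal NK -mul2n natrM -[in X in _ / X](prednK (ltnW d1)) exprS.
      by rewrite -exprM mulnC exprM; congr (_ / (_ * _ ^+ _)); ring.
    have alg (x y z : F) : x != 0 ->
        8 * (x * y) ^+ 2 * (2 * z / (4 * x ^+ 2)) = 4 * (z * y ^+ 2).
      by move=> x0; field.
    by rewrite alg // expf_neq0 // pnatr_eq0.
  by have := pbal_sqr_ge F half_bin_gt0; lra.
have d64 : d%:R <= 64 * c ^+ 4.
  have w2 := pbal_sqr_le F d.
  have y2 : 1 <= (8 * c ^+ 2 * pbal F d) ^+ 2 by rewrite exprn_ege1.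
  have c4 : 0 <= 64 * c ^+ 4 by rewrite mulr_ge0 // exprn_ge0.
  apply: (@le_trans _ _ (2 * d%:R + 1)); first by have : 0 <= d%:R :> F by []; lra.
  apply: (@le_trans _ _ ((2 * d%:R + 1) * (8 * c ^+ 2 * pbal F d) ^+ 2)).
    by rewrite ler_peMr //; have : 0 <= d%:R :> F by []; lra.
  rewrite (_ : _ * _ = 64 * c ^+ 4 * ((2 * d%:R + 1) * pbal F d ^+ 2)); last by ring.
  by rewrite ler_piMr.
rewrite -(@ler_pXn2r _ 4) ?nnegrE ?divr_ge0 //.
have c4 : 0 <= c ^+ 4 by rewrite exprn_ge0.
have -> : (t / 4) ^+ 4 = t ^+ 4 / 256 by field.
by lra.
Qed.

End OneSupport.

(** * From balanced sign counts to rational points *)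

Lemma meval_point d n (s : signs d n) (S U : {set 'I_n.+1}) : U \subset S ->
  meval (fun i => (point S U i)%:~R) (sign_poly s) =
  (\sum_(m in monomials_on d S) (- 1) ^+ (s m (+) odd_on U m))%:~R.
Proof.
move=> US; rewrite /sign_poly raddf_sum rmorph_sum [RHS]big_mkcond /=.
apply: eq_bigr => m _; rewrite mevalZ mevalX.
rewrite -[LHS](_ : ((- 1) ^+ s m * \prod_i point S U i ^+ expo m i)%:~R = _); last first.
  rewrite rmorphM rmorphXn rmorphN1 rmorph_prod; congr (_ * _).
  by apply: eq_bigr => i _; rewrite rmorphXn.
rewrite prod_point //; case: (m \in _); last by rewrite mul0r mulr0.
by rewrite mul1r signr_addb.
Qed.

Lemma sum_sign_cnt (M : finType) (D : {set M}) (f : {ffun M -> bool}) K :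
  #|D| = K.*2 -> cnt D f = K -> \sum_(m in D) (- 1) ^+ f m = 0 :> int.
Proof.
move=> DK fK.
have -> : \sum_(m in D) (- 1) ^+ f m = #|D|%:R - (cnt D f)%:R *+ 2 :> int.
  rewrite -sum1_card !natr_sum -sumrMnl -sumrB.
  by apply: eq_bigr => m _; case: (f m).
by rewrite DK fK -mul2n natrM mulr_natl subrr.
Qed.

Lemma vanishes_at_rational_point d n (s : signs d n) (S U : {set 'I_n.+1}) i0 K :
  #|S| = d.+1 -> i0 \in S -> 'C(d.*2, d) = K.*2 -> U \in sign_changes S i0 ->
  vanishes_at S K U s ->
  exists2 x : 'I_n.+1 -> rat, (exists i, x i != 0) & meval x (sign_poly s) = 0.
Proof.
move=> cardS i0S NK /sign_changesP[US iU _] /eqP zU.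
exists (fun i => (point S U i)%:~R).
  (* [i0] lies in [S] but not in [U], so its coordinate is 1. *)
  by exists i0; rewrite /point (negbTE iU) i0S.
rewrite meval_point // (eq_bigr (fun m => (- 1) ^+ (shift (@odd_on d n U) s) m)).
  by rewrite (sum_sign_cnt _ zU) // card_monomials_on.
by move=> m _; rewrite ffunE.
Qed.

(** * Combining the [n - d + 1] supports *)

Section Supports.
Variables (d n : nat).
Hypotheses (d1 : (1 < d)%N) (dn : (d <= n)%N).

Definition support (i : nat) := [set j : 'I_n.+1 | (j < d)%N || (j == d + i :> nat)%N].

Lemma card_support i : (i <= n - d)%N -> #|support i| = d.+1.
Proof.
move=> idn; have dil : (d + i < n.+1)%N by lia.
have -> : support i = Ordinal dil |: [set widen_ord (leqW dn) j | j in 'I_d].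
  apply/setP => j; rewrite !inE orbC -(inj_eq val_inj) /=; congr (_ || _).
  apply/idP/imsetP => [jd|[k _ ->]]; last exact: (ltn_ord k).
  by exists (Ordinal jd) => //; apply: val_inj.
rewrite cardsU1 card_imset ?card_ord; last by move=> j k [/val_inj].
case: imsetP => [[k _ /(congr1 val) /= e]|] //.
  by have := ltn_ord k; lia.
Qed.

Lemma ord0_support i : ord0 \in support i.
Proof. by rewrite inE (ltnW d1). Qed.

(** The witness is [x_(d + i) ^ d]; flipping its sign affects only the [i]-th support, as
    [prob_no_success] requires. *)
Lemma private_monomial i : (i <= n - d)%N ->
  exists m : monomial d n, forall j, (j <= n - d)%N ->
    (m \in monomials_on d (support j)) = (i == j).
Proof.
move=> idn; have dil : (d + i < n.+1)%N by lia.
have [|m mE] := @expo_exists d n (fun j => if j == Ordinal dil then d else 0)%N.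
  by rewrite -big_mkcond big_pred1_eq.
exists m => j jdn; rewrite inE; apply/forallP/eqP => [/(_ (Ordinal dil))|<- k].
  by rewrite mE eqxx !inE /=; lia.
by rewrite mE; case: (eqVneq k (Ordinal dil)) => [->|_]; rewrite ?implybT // inE /= eqxx orbT.
Qed.

Lemma prob_no_zero (F : realFieldType) (t : F) K (k := (n - d).+1) :
  'C(d.*2, d) = K.*2 -> 0 < t -> t ^+ 4 <= d%:R ->
  prob F (fun s : {ffun monomial d n -> bool} =>
    all (fun i => ~~ [exists U in sign_changes (support i) ord0,
                        vanishes_at (support i) K U s]) (iota 0 k))
    <= 1 / 2 ^+ k + 2 * (1 / t + 4 * (5 / 8) ^+ d.+1).
Proof.
move=> NK t0 td.
have [m mE] : exists m : nat -> monomial d n, forall i j, (i < k)%N -> (j < k)%N ->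
    (m i \in monomials_on d (support j)) = (i == j).
  (* [choice] asks for a monomial at every [i], so indices from [k] on get an arbitrary one. *)
  have P i : exists m : monomial d n, (i < k)%N -> forall j, (j < k)%N ->
      (m \in monomials_on d (support j)) = (i == j).
    case: (ltnP i k) => ik; first by have [m] := private_monomial ik; exists m.
    by have [m _] := private_monomial (leq0n (n - d)); exists m.
  by have [m mP] := choice P; exists m => i j ik jk; exact: mP.
apply: (@prob_no_success F _ k (fun i => @good_mod4 d n (support i) K)
  (fun i s => [exists U in sign_changes (support i) ord0, vanishes_at (support i) K U s]) m).
- by apply: addr_ge0; [exact/divr_ge0/ltW|rewrite mulr_ge0 // exprn_ge0 ?divr_ge0].
- by move=> i s ik; rewrite good_mod4_toggle // mE ?eqxx.
- by move=> i j s ik jk /negbTE ij; rewrite /good_mod4 cnt_flip_out // mE // ij.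
- move=> i j s ik jk /negbTE ij; apply: eq_existsb => U.
  suff -> : vanishes_at (support j) K U (flip (m i) s) = vanishes_at (support j) K U s by [].
  have shift_flip : shift (@odd_on d n U) (flip (m i) s) = flip (m i) (shift (@odd_on d n U) s).
    by apply/ffunP => l; rewrite !ffunE addbAC.
  by rewrite /vanishes_at shift_flip cnt_flip_out // mE // ij.
move=> i ik; have cardSi := card_support ik; have i0S := ord0_support i.
apply: (le_trans (prob_good_not_vanishes F d1 cardSi i0S NK)).
rewrite lerD2r.
have := expected_zeros_ge d1 cardSi i0S NK (ltW t0) td.
move: (#|_|%:R * _) => e et; have e0 : 0 < e by apply: lt_le_trans et; rewrite divr_gt0.
rewrite !div1r lef_pV2 ?posrE ?mulr_gt0 //.
by lra.
Qed.

End Supports.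

(** * From polynomials to hypersurfaces, and the final estimate *)

Lemma norm_r_sub1_le (R : realType) d n (P : pred (signs d n)) :
  (forall s, ~~ P s ->
    exists2 x : 'I_n.+1 -> rat, (exists i, x i != 0) & meval x (sign_poly s) = 0) ->
  `|r R d n - 1| <= prob R P.
Proof.
move=> HP; set Good := [set V in BB d n | `[< has_rational_point V >]].
set Bad := BB d n :\: Good.
have cardV (V : {set signs d n}) : V \in BB d n -> #|V| = 2%N.
  move=> /imsetP[s _ ->]; rewrite (_ : [set _ | _ & _] = [set s; opp_signs s]).
    rewrite cards2; suff -> : s != opp_signs s by [].
    have /card_gt0P[m _] : (0 < #|monomial d n|)%N.
      by rewrite card_monomial bin_gt0 leq_addl.
    by apply/eqP => /ffunP/(_ m); rewrite ffunE; case: (s m).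
  by apply/setP => t; rewrite !inE same_hypersurfaceE.
have BBpart := @BB_partition d n; have /and3P[_ trivBB _] := BBpart.
have BBsigns : (#|BB d n| * 2)%N = #|signs d n|.
  by rewrite -cardsT (card_uniform_partition cardV BBpart).
(* Both polynomials of a hypersurface without rational points satisfy [P]. *)
have BadP : (#|Bad| * 2 <= #|P|)%N.
  have trivBad : trivIset Bad by apply: trivIsetS trivBB; exact: subsetDl.
  have <- : (\sum_(V in Bad) #|V| = #|Bad| * 2)%N.
    rewrite -sum_nat_const; apply: eq_bigr => V /setDP[VBB _]; exact: cardV.
  rewrite (eqP trivBad); apply/subset_leq_card/subsetP => s /bigcupP[V].
  rewrite inE => /andP[VG VBB] sV; apply: contraR VG => /HP z.
  by rewrite inE VBB; apply/asboolP; exists s.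
have N0 : 0 < #|BB d n|%:R :> R by rewrite ltr0n card_BB expn_gt0.
have -> : r R d n - 1 = - (#|Bad|%:R / #|BB d n|%:R).
  have GB : Good \subset BB d n by apply/subsetP => V; rewrite inE => /andP[].
  rewrite /r -/Good cardsDS // natrB ?subset_leq_card //.
  by field; rewrite lt0r_neq0.
rewrite normrN ger0_norm ?divr_ge0 // ler_pdivrMr // /prob /mean.
rewrite -BBsigns natrM.
have -> : \sum_s (P s)%:R = #|P|%:R :> R.
  rewrite -sum1_card natr_sum [RHS]big_mkcond; apply: eq_bigr => s _.
  by rewrite -[s \in P]/(P s); case: (P s).
rewrite (_ : _ / _ * _ = #|P|%:R / 2); last by field; rewrite lt0r_neq0.
by rewrite ler_pdivlMr // -natrM ler_nat.
Qed.

Theorem theorem1p1 (R : realType) :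
  exists C : R, 0 < C /\
    forall d n : nat, (2 <= d)%N -> (2 <= n)%N ->
      d%:R + ln (d%:R : R) <= n%:R ->
      `|r R d n - 1| <= C / (d%:R `^ (1 / 4)).
Proof.
(* [19 = 1 + 2 * (1 + 4 * 2)]: in [prob_no_zero] the first term is at most [1 / t] and
   [(5 / 8) ^ (d + 1)] at most [2 / t], with [t = d ^ (1/4)]. *)
exists 19; split=> // d n d1 _ dn.
have d0 : 0 < d%:R :> R by rewrite ltr0n ltnW.
have d_ge1 : 1 <= d%:R :> R by rewrite ler1n ltnW.
have lnd0 : 0 <= ln d%:R :> R by exact: ln_ge0.
have dn' : (d <= n)%N by rewrite -(ler_nat R); lra.
set t := d%:R `^ (1 / 4).
have t0 : 0 < t by exact: powR_gt0.
have t4 : t ^+ 4 = d%:R.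
  by rewrite -powR_mulrn ?ltW // -powRrM (_ : 1 / 4 * 4 = 1) ?powRr1 ?ltW //; field.
have [K NK] : exists K, 'C(d.*2, d) = K.*2.
  exists 'C(d.*2.-1, d); have := mul_bin_down d.*2 d.
  by rewrite -addnn addnK; nia.
(* Here [ln t = ln d / 4 <= (n - d) / 2], and [ln 2 >= 1 / 2] follows from [ln (1 + x) <= x] at
   [x = - 1 / 2]. *)
have tk : t <= 2 ^+ (n - d).
  have ln2 : 1 / 2 <= ln 2 :> R.
    have := @le_ln1Dx R (- (1 / 2)); rewrite (_ : 1 - 1 / 2 = 2^-1); last by field.
    by rewrite lnV ?posrE //; lra.
  rewrite -ler_ln ?posrE ?exprn_gt0 // ln_powR lnXn // -[leRHS]mulr_natr natrB //.
  have : (1 / 2) * (n%:R - d%:R) <= ln 2 * (n%:R - d%:R) :> R.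
    by rewrite ler_wpM2r //; lra.
  by lra.
(* The crude bounds [(8 / 5) ^ j >= j / 2] and [t <= d + 1] suffice. *)
have t58 : (5 / 8) ^+ d.+1 <= 2 / t.
  have pow j : j%:R / 2 <= (8 / 5) ^+ j :> R.
    elim: j => [|j IH]; first by rewrite mul0r.
    have j1 : 1 <= (8 / 5) ^+ j :> R by apply: exprn_ege1; lra.
    by rewrite exprS -natr1; lra.
  have td : t <= d.+1%:R.
    by apply: (@le_trans _ _ d%:R); [apply: ler1_powR => //; lra|rewrite ler_nat].
  rewrite -(invf_div 8 5) -(invf_div t 2) exprVn lef_pV2 ?posrE ?exprn_gt0 ?divr_gt0 //.
  by apply: le_trans _ (pow _); rewrite ler_pM2r ?invr_gt0.
apply: le_trans (norm_r_sub1_le _ _) _; last first.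
  apply: (le_trans (prob_no_zero d1 dn' NK t0 _)); first by rewrite t4.
  have e2 : 1 / 2 ^+ (n - d).+1 <= 1 / t.
    rewrite !div1r lef_pV2 ?posrE ?exprn_gt0 // exprS.
    by apply: (le_trans tk); rewrite ler_peMl ?exprn_ge0 // ler1n.
  rewrite (_ : 19 / t = 1 / t + 2 * (1 / t + 4 * (2 / t))); last by field; rewrite lt0r_neq0.
  by rewrite lerD // ler_wpM2l // lerD2l ler_wpM2l.
move=> s /allPn[i ik] /negPn/exists_inP[U UX zU].
apply: (vanishes_at_rational_point _ _ NK UX zU); last exact: ord0_support.
by apply: card_support => //; move: ik; rewrite mem_iota.
Qed.
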